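(* Let $\mathcal X$ be a finite set and let $\mathcal C$ be an arbitrary set of probability measures on $(\mathcal X^\infty,\mathcal F)$. Then the statistician has a minimax strategy, that is, there exists $\rho^*\in\mathcal P$ on which the upper value is attained: $$\sup_{W\in\mathcal C^*}E_{W(\mu)}D(\mu,\rho^* )=\bar V_{\mathcal C}:=\inf_{\rho\in\mathcal P}\ \sup_{W\in\mathcal C^*}E_{W(\mu)}D(\mu,\rho).$$
   Context: $\mathcal X$ is a finite set, $\mathcal X^\infty$ is the set of one-way infinite sequences over $\mathcal X$, and $\mathcal F$ is the usual Borel sigma-field on $\mathcal X^\infty$ (generated by the cylinder sets). $\mathcal P$ denotes the set of all probability measures on $(\mathcal X^\infty,\mathcal F)$; its elements are called predictors, or strategies of the statistician. The elements of $\mathcal C\subseteq\mathcal P$ are the basic strategies of the opponent. $x_{1..n}$ denotes $x_1,\dots,x_n$, and for $\mu\in\mathcal P$, $\mu(x_{1..n})$ is the $\mu$-probability of the set of infinite sequences starting with $x_{1..n}$. Logarithms are to base 2. For $\mu,\rho\in\mathcal P$ and $n\in\mathbb N$ (positive integers), $$d_n(\mu,\rho):=\sum_{x_{1..n}\in\mathcal X^n}\mu(x_{1..n})\log\frac{\mu(x_{1..n})}{\rho(x_{1..n})}\in[0,+\infty],$$ with the usual conventions (terms with $\mu(x_{1..n})=0$ are $0$; terms with $\mu(x_{1..n})>0=\rho(x_{1..n})$ are $+\infty$), and $$D(\mu,\rho):=\limsup_{n\to\infty}\frac1n d_n(\mu,\rho).$$ $\mathcal P$ is equipped with the Borel sigma-field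 of the topology of weak convergence (equivalently, the sigma-field generated by the maps $\mu\mapsto\mu(x_{1..n})$). $\mathcal C^*$ denotes the set of all probability distributions over measurable subsets of $\mathcal C$ (i.e. probability measures $W$ on $\mathcal P$ with $W(S)=1$ for some measurable $S\subseteq\mathcal C$); these are the randomized strategies of the opponent. $E_{W(\mu)}$ denotes expectation when $\mu$ is drawn according to $W$. A minimax strategy of the statistician is a $\rho\in\mathcal P$ on which the infimum defining the upper value $\bar V_{\mathcal C}$ is attained. *)

(* Defs.v *)
From HB Require Import structures.
From mathcomp Require Import all_boot all_order all_algebra.
From mathcomp Require Import all_classical all_reals all_analysis.
From mathcomp Require Import measurable_realfun giry.

Set Implicit Arguments.
Unset Strict Implicit.
Unset Printing Implicit Defensive.

Import Order.TTheory GRing.Theory Num.Theory.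
Import numFieldNormedType.Exports.

Local Open Scope classical_set_scope.
Local Open Scope ring_scope.

(* Nonempty finite alphabets: over the empty alphabet there is no predictor.
   The distinguished point is only there because measurable types are pointed;
   no definition below mentions it. *)
#[short(type="finPointedType")]
HB.structure Definition FinPointed := {X of Pointed X & Finite X}.

(* Sequences are indexed from 0, so the word x_1, ..., x_n is matched against
   w 0, ..., w (n - 1). *)
Definition cylinder (X : Type) (n : nat) (x : n.-tuple X) : set (nat -> X) :=
  [set w | forall i : 'I_n, w i = tnth x i].

Definition cylinders (X : Type) : set (set (nat -> X)) :=
  [set A | exists (n : nat) (x : n.-tuple X), A = cylinder x].

Definition infseq (X : finPointedType) : measurableType _ :=
  g_sigma_algebraType (@cylinders X).

Definition predictor (R : realType) (X : finPointedType) : measurableType _ :=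
  pprobability (infseq X) R.

Section predictor_measurable.
Local Open Scope ereal_scope.
Context (R : realType) (X : finPointedType).

Definition word_events : set (set (predictor R X)) :=
  [set S | exists (n : nat) (x : n.-tuple X) (B : set (\bar R)),
     measurable B /\ S = (fun mu : predictor R X => mu (cylinder x)) @^-1` B].

Lemma measurable_cylinder (n : nat) (x : n.-tuple X) :
  measurable (cylinder x : set (infseq X)).
Proof. by apply: sub_sigma_algebra; exists n, x. Qed.

Let cylinders0 : set (set (infseq X)) := set0 |` @cylinders X.

Let cylinders0_setI : setI_closed cylinders0.
Proof.
have sub n m (x : n.-tuple X) (y : m.-tuple X) : (n <= m)%N ->
    cylinders0 (cylinder x `&` cylinder y).
  move=> nm.
  have [->|/set0P[w [wx wy]]] := eqVneq (cylinder x `&` cylinder y) set0.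
    by left.
  right; exists m, y; apply/seteqP; split=> [v []//|v vy]; split=> // i.
  by rewrite -wx (vy (widen_ord nm i)) -(wy (widen_ord nm i)).
move=> A B [->|[n [x ->]]]; first by rewrite set0I; left.
move=> [->|[m [y ->]]]; first by rewrite setI0; left.
by case/orP: (leq_total n m) => nm; [|rewrite setIC]; exact: sub.
Qed.

Let measurable_infseqE : @measurable _ (infseq X) = <<s cylinders0 >>.
Proof.
apply/seteqP; split.
  by apply: sub_sigma_algebra2 => A GA; right.
apply: smallest_sub; first exact: sigma_algebra_measurable.
by move=> A [->|GA]; [exact: measurable0|exact: sub_sigma_algebra].
Qed.

Let predictor' : measurableType _ := g_sigma_algebraType word_events.

Let measurable_ev (U : set (infseq X)) : measurable U ->
  measurable_fun [set: predictor']
    (fun mu : predictor' => (mu : predictor R X) U).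
Proof.
rewrite measurable_infseqE; move: U; apply: dynkin_induction => //.
- rewrite (_ : (fun _ => _) = cst 1)//; apply/funext => mu.
  exact: probability_setT.
- move=> U [->|[n [x ->]]].
    by rewrite (_ : (fun _ => _) = cst 0)//; apply/funext => mu; rewrite measure0.
  move=> _ B mB; rewrite setTI; apply: sub_sigma_algebra.
  by exists n, x, B.
- move=> U mU PU.
  rewrite (_ : (fun _ => _) = (fun mu : predictor' =>
      1 - (mu : predictor R X) U)).
    exact: emeasurable_funB.
  by apply/funext => mu; rewrite -probability_setC.
- move=> F mF tF PF.
  rewrite (_ : (fun _ => _) = (fun mu : predictor' =>
      \sum_(0 <= i <oo) (mu : predictor R X) (F i))); last first.
    apply/funext => mu; rewrite measure_semi_bigcup//.
    exact: bigcup_measurable.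
  by apply: ge0_emeasurable_sum.
Qed.

(* The sigma-field on predictors is the one generated by the word
   probabilities. *)
Lemma measurable_predictorE :
  @measurable _ (predictor R X) = <<s word_events >>.
Proof.
apply/seteqP; split.
  apply: smallest_sub; first exact: smallest_sigma_algebra.
  move=> _ [r r01 [U mU <-]].
  have := emeasurable_fun_infty_o measurableT (measurable_ev mU) r%:E.
  by rewrite setTI.
apply: smallest_sub; first exact: sigma_algebra_measurable.
move=> _ [n [x [B [mB ->]]]].
have := @measurable_kernel _ _ _ _ _
  (kprobability (@measurable_id _ (predictor R X) setT))
  _ (measurable_cylinder x) measurableT B mB.
by rewrite setTI.
Qed.

End predictor_measurable.

Section divergence.
Context (R : realType) (X : finPointedType).
Implicit Types mu rho : predictor R X.

Definition wordp mu (n : nat) (x : n.-tuple X) : R := fine (mu (cylinder x)).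

Definition log2 (x : R) : R := ln x / ln 2.

Definition kl_term (p q : R) : \bar R :=
  if p == 0 then 0%E else if q == 0 then +oo%E else (p * log2 (p / q))%:E.

Definition dn (n : nat) mu rho : \bar R :=
  (\sum_(x : n.-tuple X) kl_term (wordp mu x) (wordp rho x))%E.

(* The index n = 0, where the term is 0, does not affect the upper limit. *)
Definition D mu rho : \bar R :=
  limn_esup (fun n => (n%:R^-1)%:E * dn n mu rho)%E.

End divergence.

Section game.
Context (R : realType) (X : finPointedType).
Implicit Types (C : set (predictor R X)) (rho : predictor R X).

(* A term of type [probability] also assigns values to non-measurable sets, so
   that distinct terms may represent the same measure; membership in C is taken
   up to equality on measurable sets. With plain inclusion in C, randomized C
   could be empty for C a singleton, because measurable sets of predictors
   cannot tell apart two such terms. *)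
Definition randomized C : set (probability (predictor R X) R) :=
  [set W | exists S : set (predictor R X),
     [/\ measurable S,
         S `<=` [set mu | exists2 nu, C nu & measure_eq mu nu]
       & W S = 1%E]].

Definition worst_risk C rho : \bar R :=
  ereal_sup [set (\int[W]_mu D mu rho)%E | W in randomized C].

Definition upper_value C : \bar R := ereal_inf (range (worst_risk C)).

End game.

(* Main.v *)
Require Import Defs.
From HB Require Import structures.
From mathcomp Require Import all_boot all_order all_algebra.
From mathcomp Require Import all_classical all_reals all_analysis.

(** The infimum is attained because the average log-loss of a Bayesian mixture
is asymptotically no worse than that of any of its components.  Take predictors
[rho k] whose worst risks converge to the upper value, and let [rho] be the
mixture of the [rho k] with weights 2^-(k+1) ([mixture]).  On every event,
[rho] is at least 2^-(k+1) times [rho k] ([mixture_domination]), so replacing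
[rho k] by [rho] costs at most k+1 bits in each d_n, whatever n is
([dn_domination]).  After division by n this constant vanishes in the limit, so
D(mu, rho) <= D(mu, rho k) for all mu and k at once ([D_domination]).
Integrating against any randomized strategy of the opponent shows that the
worst risk of [rho] is at most that of every [rho k], hence at most the upper
value. *)

Set Implicit Arguments.
Unset Strict Implicit.
Unset Printing Implicit Defensive.

Import Order.TTheory GRing.Theory Num.Theory.
Import numFieldNormedType.Exports.

Local Open Scope classical_set_scope.
Local Open Scope ring_scope.

Section analysis_lemmas.
Local Open Scope ereal_scope.

(** The integral of a nonnegative function, measurable or not, is a supremum over
the simple functions below it, which only grows with the function; the general
integral is the difference of those of the positive and negative parts. *)
Lemma le_integral_pointwise d (T : measurableType d) (R : realType)
    (mu : {measure set T -> \bar R}) (f g : T -> \bar R) :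
  (forall x, f x <= g x) -> \int[mu]_x f x <= \int[mu]_x g x.
Proof.
move=> fg; rewrite /integral !patch_setT; apply: leeB.
- apply: ereal_sup_le => _ [h /= hf <-]; exists h => // x.
  by apply: le_trans (hf x) _; apply: funepos_le (in_setT x) => y _; exact: fg.
- apply: ereal_sup_le => _ [h /= hg <-]; exists h => // x.
  by apply: le_trans (hg x) _; apply: funeneg_le (in_setT x) => y _; exact: fg.
Qed.

(** Upper limits of extended sequences are not subadditive in general, because of
sums of opposite infinities; a real perturbation that vanishes at infinity
escapes this problem, being eventually smaller than any e > 0. *)
Lemma le_limn_esup_add_null (R : realType) (u w : (\bar R)^nat) (v : R^nat) :
  v @ \oo --> (0 : R)%R -> (forall n, w n <= u n + (v n)%:E) ->
  limn_esup w <= limn_esup u.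
Proof.
move=> v0 wuv; rewrite !limn_esup_lim; apply/lee_addgt0Pr => e e0.
have ue : esups u n + e%:E @[n --> \oo] --> limn (esups u) + e%:E.
  apply: cvgeD; [exact: fin_num_adde_defl|exact: is_cvg_esups|exact: cvg_cst].
rewrite -(cvg_lim _ ue)//; apply: lee_lim; first exact: is_cvg_esups.
  by apply/cvg_ex; eexists; exact: ue.
have [N _ Nv] : \forall n \near \oo, (v n < e)%R by exact: cvgr_lt v0 _ e0.
exists N => // n /= Nn; apply: ge_ereal_sup => _ [k /= nk <-].
apply: le_trans (wuv k) _; apply: leeD.
  by apply: ereal_sup_ubound; exists k.
by rewrite lee_fin ltW//; apply: Nv => /=; exact: leq_trans nk.
Qed.

End analysis_lemmas.

Section divergence_domination.
Context (R : realType) (X : finPointedType).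
Implicit Types mu rho nu : predictor R X.

Lemma wordp_ge0 mu n (x : n.-tuple X) : 0 <= wordp mu x.
Proof. exact: fine_ge0. Qed.

Lemma wordpE mu n (x : n.-tuple X) : (wordp mu x)%:E = mu (cylinder x).
Proof. by rewrite fineK// fin_num_measure//; exact: measurable_cylinder. Qed.

(** The words of a given length partition the infinite sequences; this is what
turns a cost per unit of [mu]-mass into a constant cost in [dn_domination]. *)
Lemma sum_wordp mu n : \sum_(x : n.-tuple X) wordp mu x = 1.
Proof.
apply: EFin_inj; rewrite -sumEFin; under eq_bigr do rewrite wordpE.
have -> : (\sum_(x : n.-tuple X) mu (cylinder x) =
    \sum_(x \in [set: n.-tuple X]) mu (cylinder x))%E.
  rewrite bigfs ?index_enum_uniq// => [|x _]; last by rewrite mem_index_enum.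
  by have -> : [set` xpredT] = [set: n.-tuple X] by exact/seteqP.
rewrite -measure_fin_bigcup; last 3 first.
- exact: finite_finset.
- move=> x y _ _ [w [wx wy]]; apply: eq_from_tnth => i.
  by rewrite -wx -wy.
- by move=> x _; exact: measurable_cylinder.
rewrite -(probability_setT mu); congr (mu _); apply/seteqP; split=> // w _.
by exists [tuple w i | i < n] => // i; rewrite tnth_mktuple.
Qed.

(** Scaling the second argument by a factor [c] multiplies the likelihood ratio
by 1/c, hence adds [- log2 c] per unit of mass. *)
Lemma kl_term_domination (c p q q' : R) : 0 < c -> 0 <= p -> 0 <= q ->
  c * q <= q' -> (kl_term p q' <= kl_term p q + (p * - log2 c)%:E)%E.
Proof.
move=> c0 p0 q0 cqq'; rewrite /kl_term; case: eqVneq => [->|pN0].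
  by rewrite mul0r adde0.
case: (eqVneq q 0) => [_|qN0]; first by rewrite addye ?leey.
have pp : 0 < p by rewrite lt_neqAle eq_sym pN0.
have qp : 0 < q by rewrite lt_neqAle eq_sym qN0.
have q'p : 0 < q' by apply: lt_le_trans cqq'; rewrite mulr_gt0.
rewrite (gt_eqF q'p) -EFinD lee_fin -mulrDr ler_pM2l// /log2 -mulrBl.
(* Write ln (p / q) - ln c as the logarithm of p / q / c. *)
rewrite ler_pM2r ?invr_gt0 ?ln_gt0 ?ltr1n//.
rewrite -ln_div ?posrE ?divr_gt0// ler_ln ?posrE ?divr_gt0//.
by rewrite -mulrA -invfM ler_pM2l// lef_pV2 ?posrE ?mulr_gt0// mulrC.
Qed.

Lemma dn_domination (c : R) mu rho nu n : 0 < c ->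
  (forall x : n.-tuple X, c * wordp rho x <= wordp nu x) ->
  (dn n mu nu <= dn n mu rho + (- log2 c)%:E)%E.
Proof.
move=> c0 H.
have -> : - log2 c = \sum_(x : n.-tuple X) wordp mu x * - log2 c.
  by rewrite -mulr_suml sum_wordp mul1r.
rewrite -sumEFin /dn -big_split /=; apply: lee_sum => x _.
by apply: kl_term_domination => //; exact: wordp_ge0.
Qed.

(** The constant [c] must not depend on the word length: its cost [- log2 c] in
[dn] is then killed by the factor 1/n. *)
Lemma D_domination (c : R) mu rho nu : 0 < c ->
  (forall n (x : n.-tuple X), c * wordp rho x <= wordp nu x) ->
  (D mu nu <= D mu rho)%E.
Proof.
move=> c0 H; apply: (@le_limn_esup_add_null _ _ _ (fun n => n%:R^-1 * - log2 c)).
  rewrite -[X in _ --> X](mul0r (- log2 c)).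
  apply: cvgMl; rewrite -(cvg_shiftS (fun n => n%:R^-1 : R)); exact: cvg_harmonic.
move=> n; rewrite EFinM -muleDr ?fin_num_adde_defl//.
by apply: lee_wpmul2l; [rewrite lee_fin|exact: dn_domination].
Qed.

End divergence_domination.

Section mixture.
Local Open Scope ereal_scope.
Context (R : realType) d (T : measurableType d).
Variable P : (probability T R)^nat.

Let half_pow (k : nat) : {nonneg R} := ((2 ^ k.+1)%:R^-1)%:nng%R.

Definition mixture := mseries (fun k => mscale (half_pow k) (P k)) 0.

HB.instance Definition _ := Measure.on mixture.

Let mixture_setT : mixture [set: T] = 1.
Proof.
have mk k : mscale (half_pow k) (P k) [set: T] = ((2 ^ k.+1)%:R^-1)%:E.
  by rewrite -[RHS]mule1 -(probability_setT (P k)).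
transitivity (\sum_(0 <= k <oo) ((2 ^ k.+1)%:R^-1 : R)%:E).
  by apply: eq_eseriesr => k _; exact: mk.
have := @cvg_geometric_eseries_half R 1 0.
rewrite expr0 divr1 => /cvg_lim <-//; apply: congr_lim; apply/funext => n /=.
by apply: eq_bigr => k _; rewrite addn1 div1r.
Qed.

HB.instance Definition _ := Measure_isProbability.Build _ _ _ mixture mixture_setT.

(** The mixture is a series of nonnegative terms, of which the left-hand side
is one. *)
Lemma mixture_domination k (A : set T) :
  ((2 ^ k.+1)%:R^-1)%:E * P k A <= mixture A.
Proof.
rewrite /mixture /mseries.
apply: le_trans (nneseries_lim_ge k.+1 _) => //.
by rewrite big_nat_recr//= leeDr// sume_ge0.
Qed.

End mixture.

Section minimax.
Context (R : realType) (X : finPointedType).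
Implicit Types (C : set (predictor R X)) (rho nu : predictor R X).

Lemma worst_risk_domination C (c : R) rho nu : 0 < c ->
  (forall n (x : n.-tuple X), c * wordp rho x <= wordp nu x) ->
  (worst_risk C nu <= worst_risk C rho)%E.
Proof.
move=> c0 H; apply: ge_ereal_sup => _ [W CW <-].
apply: le_trans (le_integral_pointwise W (fun mu => D_domination mu c0 H)) _.
by apply: ereal_sup_ubound; exists W.
Qed.

End minimax.

Theorem corollary1 (R : realType) (X : finPointedType)
    (C : set (predictor R X)) :
  exists rho : predictor R X, worst_risk C rho = upper_value C.
Proof.
have range0 : range (worst_risk C) != set0.
  by apply/set0P; exists (worst_risk C point); exists point.
have [u uP uV] := ereal_inf_seq range0.
have /choice[rho rhoE] : forall k, exists r, worst_risk C r = u k.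
  by move=> k; have [r _ <-] := uP k; exists r.
pose mix : predictor R X := mixture rho.
exists mix; apply/eqP; rewrite eq_le; apply/andP; split; last first.
  by apply: ereal_inf_lbound; exists mix.
rewrite /upper_value -(cvg_lim _ uV)//.
apply: lime_ge; first by apply/cvg_ex; eexists; exact: uV.
apply: nearW => k; rewrite -rhoE.
apply: (@worst_risk_domination _ _ _ ((2 ^ k.+1)%:R^-1)).
  by rewrite invr_gt0 ltr0n expn_gt0.
move=> n x; rewrite -lee_fin EFinM !wordpE.
exact: mixture_domination.
Qed.
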